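(* Let $R_3\approx2.553$ be the unique positive root of $R_3^6+R_3^5-4R_3^4-8R_3^3-10R_3^2-6R_3-2=0$. Let $0=t_0<t_1<\cdots<t_N=T$ be a time grid with $\tau_k=t_k-t_{k-1}$, $\tau=\max_{1\le k\le N}\tau_k$ and step ratios $r_k=\tau_k/\tau_{k-1}$ satisfying $0<r_k<R_3$ for $2\le k\le N$, and let $f$ be Lipschitz continuous with Lipschitz constant $L_f>0$. Let $C_3>0$ be the constant, independent of the time $t_n$, whose existence is guaranteed for such step ratios, with $$\sum_{j=3}^{n}\big|\vartheta_{n-j}^{(3,n)}\big|\le C_3\quad\text{and}\quad\sum_{j=i}^{n}\big|\vartheta_{j-i}^{(3,j)}\big|\le C_3\qquad\text{for }n\ge i\ge3,$$ where $\vartheta_{n-j}^{(3,n)}$ are the BDF3 discrete orthogonal convolution kernels. Let $v^n$ and $\bar v^n$ satisfy $$D_3v^n=f(t_n,v^n),\qquad D_3\bar v^n=f(t_n,\bar v^n)+\varepsilon^n\qquad\text{for }3\le n\le N,$$ with a bounded sequence $\{\varepsilon^n\}$, so that $\tilde v^n:=\bar v^n-v^n$ solves $$D_3\tilde v^i=f(t_i,\bar v^i)-f(t_i,v^i)+\varepsilon^i\qquad\text{for }3\le i\le N.$$ If $\tau\le 1/(4C_3L_f)$, then $$|\tilde v^{n}|\le 2\exp(4C_3L_ft_{n-1})\Big(|\tilde v^{2}|+5C_3\tau\,|\partial_\tau\tilde v^{2}|+2C_3\tau\,|\partial_\tau\tilde v^{1}|+2C_3t_n\max_{3\le i\le n}|\varepsilon^i|\Big)\qquad\text{for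 }3\le n\le N.$$ Thus the variable-step BDF3 scheme is stable if $0<r_k<R_3$ for $k\ge2$.
   Context: The scheme approximates the initial value problem $dv/dt=f(t,v)$ for $0<t\le T$. The function $f(t,v)$ is Lipschitz continuous in $v$ with constant $L_f$: $|f(t,v)-f(t,w)|\le L_f|v-w|$. For a sequence $\{v^n\}_{n=0}^N$, $\partial_\tau v^n:=(v^n-v^{n-1})/\tau_n$. For $x,y\ge0$ define $$d_0(x,y):=\frac{1+2x}{1+x}+\frac{xy}{1+y+xy},$$ $$d_1(x,y):=-\frac{x}{1+x}-\frac{xy}{1+y+xy}-\frac{xy^2}{1+y+xy}\,\frac{1+x}{1+y},$$ $$d_2(x,y):=\frac{xy^2}{1+y+xy}\,\frac{1+x}{1+y}.$$ The variable-step BDF3 formula is $$D_3v^n:=d_0(r_n,r_{n-1})\,\partial_\tau v^n+d_1(r_n,r_{n-1})\,\partial_\tau v^{n-1}+d_2(r_n,r_{n-1})\,\partial_\tau v^{n-2}\qquad\text{for }n\ge3.$$ The starting values ($n=0,1,2$) of $v^n$ and $\bar v^n$ are assumed given. BDF3 kernels: for $n\ge3$, $d^{(3,n)}_j:=d_j(r_n,r_{n-1})$ for $j=0,1,2$ and $d^{(3,n)}_j:=0$ for $3\le j\le n-1$. The discrete orthogonal convolution (DOC) kernels are defined recursively, for $n\ge3$, by $$\vartheta_0^{(3,n)}:=\frac1{d_0^{(3,n)}},\qquad \vartheta_{n-j}^{(3,n)}:=-\frac{1}{d_0^{(3,j)}}\sum_{i=j+1}^n\vartheta_{n-i}^{(3,n)}d_{i-j}^{(3,i)}\quad\text{for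 }3\le j\le n-1.$$ Definition of stability (of a $k$-step scheme $D_kv^n=f(t_n,v^n)$, $k\le n\le N$, with unequal time-steps, here $k=3$): assuming $f$ is Lipschitz continuous with constant $L_f>0$, the scheme is stable (on the class of grids considered) if there exist a real number $\tau_0>0$ and a fixed constant $C$ (independent of the step sizes $\tau_n$) such that the solution of the difference equation $D_k\tilde v^i=f(t_i,\bar v^i)-f(t_i,v^i)+\varepsilon^i$, $k\le i\le N$, fulfills $$\max_{k\le n\le N}|\tilde v^{n}|\le C\Big(\sum_{i=0}^{k-1}|\tilde v^i|+\tau\sum_{i=1}^{k-1}|\partial_\tau\tilde v^i|+\max_{k\le i\le N}|\varepsilon^i|\Big)\qquad\text{whenever all }\tau_n\le\tau_0.$$ *)

(* Defs.v *)
From HB Require Import structures.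
From mathcomp Require Import all_boot all_order all_algebra.
From mathcomp Require Import reals.

Set Implicit Arguments.
Unset Strict Implicit.
Unset Printing Implicit Defensive.

Import Order.TTheory GRing.Theory Num.Theory.
Local Open Scope ring_scope.

(* A grid t_0 < ... < t_N is a function t : nat -> R of which only the values
   at 0, ..., N matter; likewise for grid functions v^0, ..., v^N. *)

Section Grid.
Variable R : realType.
Implicit Types (t v : nat -> R) (n N : nat) (T x y : R).

Definition time_grid T N t : Prop :=
  [/\ t 0%N = 0, t N = T & forall k, (0 < k <= N)%N -> t k.-1 < t k].

Definition step t n : R := t n - t n.-1.

Definition max_step N t : R := \big[Num.max/0]_(1 <= k < N.+1) step t k.

(* meaningful for n >= 2 only *)
Definition ratio t n : R := step t n / step t n.-1.

Definition ratios_below (r : R) N t : Prop :=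
  forall k, (2 <= k <= N)%N -> 0 < ratio t k < r.

(* meaningful for n >= 1 only *)
Definition dtau t v n : R := (v n - v n.-1) / step t n.

Definition d0 x y : R := (1 + 2 * x) / (1 + x) + x * y / (1 + y + x * y).

Definition d1 x y : R :=
  - (x / (1 + x)) - x * y / (1 + y + x * y)
  - x * y ^+ 2 / (1 + y + x * y) * ((1 + x) / (1 + y)).

Definition d2 x y : R :=
  x * y ^+ 2 / (1 + y + x * y) * ((1 + x) / (1 + y)).

(* bdf3_kernel t n j is the kernel d^(3,n)_j, n >= 3 *)
Definition bdf3_kernel t n (j : nat) : R :=
  match j with
  | 0 => d0 (ratio t n) (ratio t n.-1)
  | 1 => d1 (ratio t n) (ratio t n.-1)
  | 2 => d2 (ratio t n) (ratio t n.-1)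
  | _ => 0
  end.

(* meaningful for n >= 3 only *)
Definition D3 t v n : R :=
  d0 (ratio t n) (ratio t n.-1) * dtau t v n
  + d1 (ratio t n) (ratio t n.-1) * dtau t v n.-1
  + d2 (ratio t n) (ratio t n.-1) * dtau t v n.-2.

(* doc_table t n m lists the first m DOC kernels theta^(3,n)_0, ...,
   theta^(3,n)_(m-1); the entry of index m = n - j is computed from the
   previous ones. The recursion they satisfy is docE below. *)
Fixpoint doc_table t n (m : nat) : seq R :=
  if m is m'.+1 then
    let s := doc_table t n m' in
    let j := (n - m')%N in
    rcons s (if m' is 0 then 1 / bdf3_kernel t n 0
             else - (1 / bdf3_kernel t j 0) *
                  \sum_(j.+1 <= i < n.+1)
                    s`_(n - i) * bdf3_kernel t i (i - j))
  else [::].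

(* doc t n m is theta^(3,n)_m, meaningful for n >= 3 and m <= n - 3 *)
Definition doc t n m : R := (doc_table t n m.+1)`_m.

Lemma size_doc_table t n m : size (doc_table t n m) = m.
Proof. by elim: m => //= m IH; rewrite size_rcons IH. Qed.

Lemma nth_doc_table t n m l : (l < m)%N -> (doc_table t n m)`_l = doc t n l.
Proof.
elim: m => // m IH; rewrite ltnS leq_eqVlt => /predU1P[-> //|lm].
by rewrite /= nth_rcons size_doc_table lm IH.
Qed.

Lemma doc0 t n : doc t n 0 = 1 / bdf3_kernel t n 0.
Proof. by []. Qed.

Lemma docE t n j : (3 <= j < n)%N ->
  doc t n (n - j) = - (1 / bdf3_kernel t j 0) *
    \sum_(j.+1 <= i < n.+1) doc t n (n - i) * bdf3_kernel t i (i - j).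
Proof.
case/andP=> _ jn; rewrite {1}/doc /= nth_rcons size_doc_table ltnn eqxx.
rewrite subKn; last exact: ltnW.
case E: (n - j)%N => [|m]; first by move: jn; rewrite ltnNge -subn_eq0 E.
rewrite -E; congr (_ * _); apply: eq_big_nat => i /andP[ji _].
by rewrite nth_doc_table // ltn_sub2l.
Qed.

(* The bounds defining C_3, for a grid with N steps *)
Definition doc_bound (C3 : R) N t : Prop :=
  forall n i : nat, (3 <= i <= n)%N -> (n <= N)%N ->
    \sum_(3 <= j < n.+1) `|doc t n (n - j)| <= C3 /\
    \sum_(i <= j < n.+1) `|doc t j (j - i)| <= C3.

Definition lipschitz_rhs (f : R -> R -> R) T (L : R) : Prop :=
  forall s a b : R, 0 < s <= T -> `|f s a - f s b| <= L * `|a - b|.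

(* Stability of a k-step scheme D t v n = f (t n) (v n) on the class of grids
   adm; C and tau0 are chosen before the grid. Maxima of absolute values
   over index ranges are taken with default value 0. *)
Definition stable (k : nat) (D : (nat -> R) -> (nat -> R) -> nat -> R)
    (adm : nat -> (nat -> R) -> Prop) (f : R -> R -> R) : Prop :=
  exists tau0 C : R, 0 < tau0 /\
  forall N t, adm N t ->
  (forall n, (1 <= n <= N)%N -> step t n <= tau0) ->
  forall v vbar vt eps : nat -> R,
  (forall n, (n <= N)%N -> vt n = vbar n - v n) ->
  (forall i, (k <= i <= N)%N ->
     D t vt i = f (t i) (vbar i) - f (t i) (v i) + eps i) ->
  \big[Num.max/0]_(k <= n < N.+1) `|vt n| <=
  C * (\sum_(0 <= i < k) `|vt i|
       + max_step N t * \sum_(1 <= i < k) `|dtau t vt i|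
       + \big[Num.max/0]_(k <= i < N.+1) `|eps i|).

Definition R3_root x : Prop :=
  0 < x /\
  x ^+ 6 + x ^+ 5 - 4 * x ^+ 4 - 8 * x ^+ 3 - 10 * x ^+ 2 - 6 * x - 2 = 0.

End Grid.

(* Main.v *)
(** Write D3 v^n = d0 w_n + d1 w_(n-1) + d2 w_(n-2) with w = dtau v. Since
    d0 + d1 + d2 = 1, a solution of the homogeneous equation satisfies
    d0 w_n = (d0 - 1) w_(n-1) + d2 u_(n-1) and d0 u_n = d2 u_(n-1) - w_(n-1),
    where u_n = w_n - w_(n-1). With G(x) = (1 + x) / 2, the energy
    w_n^2 + G(r_n) u_n^2 contracts as soon as
    G(y) (2 d0(x,y) - 1 - G(x)) > d2(x,y)^2, which holds with a margin for all
    ratios in [0, 64/25], an interval containing [0, R3]. (A constant weight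
    G = 1 is exactly critical at x = y = R3 and gives no constant uniform in
    the ratios.) The DOC kernels are the inverse of the lower triangular matrix
    of BDF3 kernels, so each of their columns solves the homogeneous equation
    and decays geometrically; this bounds row and column sums by C3. Applying
    the inverse to D3 vt = g + eps, summing in time and using Gronwall's
    inequality gives the estimate. *)

Require Import Defs.
From mathcomp Require Import all_boot all_order all_algebra.
From mathcomp Require Import reals sequences exp.
From mathcomp Require Import ring lra zify.
Import Order.TTheory GRing.Theory Num.Theory.
Local Open Scope ring_scope.

Set Implicit Arguments.
Unset Strict Implicit.
Unset Printing Implicit Defensive.

(* all_algebra exports another constant named ratio. *)
Local Notation ratio := Defs.ratio.

Ltac nat_lia :=
  repeat match goal with
  | H : ?P |- _ =>
    lazymatch P with
    | nat => fail
    | @eq ?T _ _ => tryif unify T nat then fail else clear H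
    | is_true (negb (@eq_op _ _ _)) => fail
    | is_true (leq _ _) => fail
    | is_true (andb (leq _ _) (leq _ _)) => fail
    | _ => clear H
    end
  end; lia.

Lemma exchange_triangle (V : nmodType) (F : nat -> nat -> V) a n :
  \sum_(a <= j < n) \sum_(a <= k < j.+1) F j k =
  \sum_(a <= k < n) \sum_(k <= j < n) F j k.
Proof.
transitivity (\sum_(a <= j < n) \sum_(a <= k < n | (k < j.+1)%N) F j k).
  by apply: eq_big_nat => j /andP[aj jn]; rewrite (big_nat_widen _ _ n).
rewrite (exchange_big_dep_nat xpredT) //=.
apply: eq_big_nat => k /andP[ak kn].
by rewrite -(big_nat_widenl _ a _ xpredT (fun j => F j k)).
Qed.

Section Bdf3.
Variable R : realType.
Implicit Types (x y : R) (t w g v : nat -> R).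

(** * The characteristic root and the coefficients *)

(** Divided by x^4, the polynomial becomes x^2 + x - 4 minus positive multiples of powers of 1/x,
    which is strictly increasing for x > 0. The factored identity is this monotonicity with
    denominators cleared. *)
Lemma R3_root_unique x y : R3_root x -> R3_root y -> x = y.
Proof.
move=> [x0 hx] [y0 hy]; apply/eqP; rewrite eq_sym -subr_eq0; apply/negP => /negP yx.
have : (y - x) * ((x * y) ^+ 4 * (x + y + 1) + 8 * (x * y) ^+ 3
   + 10 * (x * y) ^+ 2 * (x + y) + 6 * (x * y) * (x ^+ 2 + x * y + y ^+ 2)
   + 2 * (x + y) * (x ^+ 2 + y ^+ 2)) =
   x ^+ 4 * (y ^+ 6 + y ^+ 5 - 4 * y ^+ 4 - 8 * y ^+ 3 - 10 * y ^+ 2 - 6 * y - 2)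
   - y ^+ 4 * (x ^+ 6 + x ^+ 5 - 4 * x ^+ 4 - 8 * x ^+ 3 - 10 * x ^+ 2 - 6 * x - 2).
  by ring.
rewrite hx hy !mulr0 subrr => /eqP; rewrite mulf_eq0 (negPf yx) /= gt_eqF //.
have xy := mulr_gt0 x0 y0.
by rewrite !(addr_gt0, mulr_gt0, exprn_gt0).
Qed.

Lemma R3_root_exists :
  exists2 r : R, R3_root r & 2553%:R / 1000%:R <= r <= 2554%:R / 1000%:R.
Proof.
pose p : {poly R} := 'X^6 + 'X^5 - 4 *: 'X^4 - 8 *: 'X^3 - 10 *: 'X^2 - 6 *: 'X - 2%:P.
have pE z : p.[z] = z ^+ 6 + z ^+ 5 - 4 * z ^+ 4 - 8 * z ^+ 3 - 10 * z ^+ 2 - 6 * z - 2.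
  by rewrite /p !hornerE.
have [||r rI /rootP pr] := @poly_ivt R p (2553%:R / 1000%:R) (2554%:R / 1000%:R).
- by lra.
- by rewrite !pE; apply/andP; split; lra.
exists r => //; split; last by rewrite -pE.
by case/andP: rI; lra.
Qed.

(* 4 (1 + x) (1 + y + x y) (1 + y)^2 times the margin of bdf3_margin below, with
   d2^2 replaced by the larger d2^2 (1 + y + x y) / ((1 + x) y). *)
Lemma lyap_poly_ge0 x y : 0 <= x <= 64 / 25 -> 0 <= y ->
  0 <= (1 + y) ^+ 3 * (2 * (1 + x) * (1 + y + x * y)
         + 4 * x * (1 + y + x * y) + 4 * x * y * (1 + x)
         - (1 + x) ^+ 2 * (1 + y + x * y))
       - 4 * x ^+ 2 * y ^+ 3 * (1 + x) ^+ 2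
       - 1 / 2 * (1 + x) * (1 + y + x * y) * (1 + y) ^+ 2.
Proof.
move=> /andP[x0 xR] y0.
have x2 : 0 <= x ^+ 2 by rewrite exprn_ge0.
have xx : x ^+ 2 <= 64 / 25 * x by nra.
have x3 : x ^+ 3 <= 64 / 25 * x ^+ 2 by rewrite exprS; nra.
have x4 : x ^+ 4 <= 64 / 25 * x ^+ 3 by rewrite exprS; have := exprn_ge0 3 x0; nra.
have x3p := exprn_ge0 3 x0.
have c0 : 0 <= 1 / 2 + 7 / 2 * x - x ^+ 2 by nra.
have c1 : 0 <= 5 / 2 + 19 * x + 7 / 2 * x ^+ 2 - x ^+ 3 by nra.
(* As a polynomial in y, only the y^3 coefficient can be negative; it is
   absorbed by c4 y^2 (y - 17/10)^2, with c4 the coefficient of y^4. *)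
pose c4 := 1 + 9 * x + 7 * x ^+ 2 - x ^+ 3.
have c4p : 0 <= c4 by rewrite /c4; nra.
have c2 : 0 <= 9 / 2 + 73 / 2 * x + 17 * x ^+ 2 - 3 * x ^+ 3 - 289 / 100 * c4.
  by rewrite /c4; nra.
have c3 : 0 <= 7 / 2 + 30 * x + 31 / 2 * x ^+ 2 - 11 * x ^+ 3 - 4 * x ^+ 4 + 34 / 10 * c4.
  by rewrite /c4; nra.
have sq : 0 <= c4 * (y - 17 / 10) ^+ 2 by rewrite mulr_ge0 ?sqr_ge0.
have y2 := exprn_ge0 2 y0.
have := mulr_ge0 c1 y0; have := mulr_ge0 y2 c2; have := mulr_ge0 y2 sq.
have := mulr_ge0 (mulr_ge0 y2 y0) c3.
rewrite /c4 => h1 h2 h3 h4.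
suff -> : (1 + y) ^+ 3 * (2 * (1 + x) * (1 + y + x * y)
         + 4 * x * (1 + y + x * y) + 4 * x * y * (1 + x)
         - (1 + x) ^+ 2 * (1 + y + x * y))
       - 4 * x ^+ 2 * y ^+ 3 * (1 + x) ^+ 2
       - 1 / 2 * (1 + x) * (1 + y + x * y) * (1 + y) ^+ 2 =
  (1 / 2 + 7 / 2 * x - x ^+ 2) +
  (5 / 2 + 19 * x + 7 / 2 * x ^+ 2 - x ^+ 3) * y +
  y ^+ 2 * (9 / 2 + 73 / 2 * x + 17 * x ^+ 2 - 3 * x ^+ 3 - 289 / 100 * c4) +
  y ^+ 2 * y * (7 / 2 + 30 * x + 31 / 2 * x ^+ 2 - 11 * x ^+ 3 - 4 * x ^+ 4 + 34 / 10 * c4) +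
  y ^+ 2 * (c4 * (y - 17 / 10) ^+ 2).
  by rewrite /c4; nra.
by rewrite /c4; field.
Qed.

Lemma d0E x y : 0 <= x -> d0 x y = 1 + x / (1 + x) + x * y / (1 + y + x * y).
Proof. by move=> x0; rewrite /d0; congr (_ + _); field; lra. Qed.

Lemma d1E x y : 0 <= x -> d1 x y = 1 - d0 x y - d2 x y.
Proof. by move=> x0; rewrite d0E // /d1 /d2; ring. Qed.

Lemma d0_ge1 x y : 0 <= x -> 0 <= y -> 1 <= d0 x y.
Proof.
move=> x0 y0; rewrite d0E //.
have xy := mulr_ge0 x0 y0.
have : 0 <= x / (1 + x) by apply: divr_ge0; lra.
have : 0 <= x * y / (1 + y + x * y) by apply: divr_ge0; lra.
lra.
Qed.

Lemma d0_le x y : 0 <= x <= 64 / 25 -> 0 <= y <= 64 / 25 -> d0 x y <= 5 / 2.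
Proof.
move=> /andP[x0 x1] /andP[y0 y1]; rewrite d0E //.
have xy := mulr_ge0 x0 y0.
have : x / (1 + x) <= 3 / 4 by rewrite ler_pdivrMr; lra.
have : x * y / (1 + y + x * y) <= 3 / 4 by rewrite ler_pdivrMr; nra.
lra.
Qed.

Lemma d2_ge0 x y : 0 <= x -> 0 <= y -> 0 <= d2 x y.
Proof.
move=> x0 y0; have xy := mulr_ge0 x0 y0.
by rewrite /d2 !(mulr_ge0, invr_ge0) ?sqr_ge0 ?addr_ge0 ?ler01.
Qed.

Lemma d2_le x y : 0 <= x <= 64 / 25 -> 0 <= y <= 64 / 25 -> d2 x y <= 7 / 4.
Proof.
move=> /andP[x0 x1] /andP[y0 y1].
have xy := mulr_ge0 x0 y0.
(* Since 1 + y + x y = 1 + (1 + x) y, both fractions have the increasing form s / (1 + s) and are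
   estimated at the right end of the range. *)
have -> : d2 x y = (x * (y / (1 + y))) * ((1 + x) * y / (1 + y + x * y)).
  by rewrite /d2; field; apply/andP; split; apply/eqP; lra.
have a1 : y / (1 + y) <= 18 / 25 by rewrite ler_pdivrMr; lra.
have b1 : (1 + x) * y / (1 + y + x * y) <= 91 / 100 by rewrite ler_pdivrMr; nra.
have a0 : 0 <= y / (1 + y) by apply: divr_ge0; lra.
have b0 : 0 <= (1 + x) * y / (1 + y + x * y) by apply: divr_ge0; nra.
have : x * (y / (1 + y)) <= 64 / 25 * (18 / 25) by apply: ler_pM.
move=> /(fun h => ler_pM (mulr_ge0 x0 a0) b0 h b1); lra.
Qed.

(** The positivity condition for one step of the energy, with G(x) = (1 + x) / 2. A margin that does
    not depend on the ratios is what yields a uniform contraction factor. *)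
Lemma bdf3_margin x y : 0 <= x <= 64 / 25 -> 0 <= y ->
  1 / 8 <= (1 + y) / 2 * (2 * d0 x y - 1 - (1 + x) / 2) - d2 x y ^+ 2.
Proof.
move=> xR y0; have /andP[x0 _] := xR.
have xy := mulr_ge0 x0 y0.
have z0 : 0 < 1 + x by lra.
have u0 : 0 < 1 + y by lra.
have q0 : 0 < 1 + y + x * y by lra.
(* The dropped factor (1 + x) y / (1 + y + x y) is at most 1; without it only one power of 1 + y + x
   y remains in the denominator. *)
have d2sq : d2 x y ^+ 2 <=
    x ^+ 2 * y ^+ 3 * (1 + x) / ((1 + y) ^+ 2 * (1 + y + x * y)).
  have -> : d2 x y ^+ 2 = x ^+ 2 * y ^+ 3 * (1 + x) /
      ((1 + y) ^+ 2 * (1 + y + x * y)) * ((1 + x) * y / (1 + y + x * y)).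
    by rewrite /d2; field; apply/andP; split; rewrite gt_eqF.
  apply: ler_piMr.
    by rewrite !(mulr_ge0, invr_ge0) ?exprn_ge0 // ltW // ?mulr_gt0 ?exprn_gt0.
  by rewrite ler_pdivrMr //; lra.
apply: le_trans (lerB (lexx _) d2sq); rewrite -subr_ge0 d0E //.
have D0 : 0 < 4 * (1 + x) * (1 + y + x * y) * (1 + y) ^+ 2.
  by rewrite !mulr_gt0 ?exprn_gt0.
have := lyap_poly_ge0 xR y0.
set P := (X in 0 <= X -> _) => P0.
suff -> : (1 + y) / 2 * (2 * (1 + x / (1 + x) + x * y / (1 + y + x * y)) - 1 - (1 + x) / 2) -
  x ^+ 2 * y ^+ 3 * (1 + x) / ((1 + y) ^+ 2 * (1 + y + x * y)) - 1 / 8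
  = P / (4 * (1 + x) * (1 + y + x * y) * (1 + y) ^+ 2).
  by apply: divr_ge0 => //; exact: ltW.
by rewrite /P; field; rewrite !gt_eqF.
Qed.

Lemma psd_form (p q s w u : R) : 0 < p -> q ^+ 2 <= p * s ->
  0 <= p * w ^+ 2 + 2 * q * w * u + s * u ^+ 2.
Proof.
move=> p0 h; rewrite -(pmulr_rge0 _ p0).
have -> : p * (p * w ^+ 2 + 2 * q * w * u + s * u ^+ 2) =
  (p * w + q * u) ^+ 2 + (p * s - q ^+ 2) * u ^+ 2 by ring.
apply: addr_ge0; first exact: sqr_ge0.
by apply: mulr_ge0; rewrite ?sqr_ge0 // subr_ge0.
Qed.

(** Here [a] and [b] stand for d0 and d2, and [g], [g'] for the old and new weights. After
    multiplication by a^2, the energy loss is a quadratic form in [w] and [u]. With factor 1 instead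
    of 499/500 its determinant is exactly a^2 times the left side of the margin condition, so the
    margin leaves room for a factor below 1. *)
Lemma energy_contraction (a b g g' w u w' u' : R) :
  1 <= a <= 5 / 2 -> 0 <= g <= 9 / 5 -> 0 <= g' ->
  1 / 8 <= g * (2 * a - 1 - g') - b ^+ 2 ->
  a * w' = (a - 1) * w + b * u -> a * u' = b * u - w ->
  w' ^+ 2 + g' * u' ^+ 2 <= 499 / 500 * (w ^+ 2 + g * u ^+ 2).
Proof.
move=> /andP[a1 a2] /andP[g0 g1] g'0 m hw hu.
have a0 : 0 < a ^+ 2 by nra.
rewrite -(ler_pM2l a0) -subr_ge0.
have -> : a ^+ 2 * (499 / 500 * (w ^+ 2 + g * u ^+ 2)) -
   a ^+ 2 * (w' ^+ 2 + g' * u' ^+ 2) =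
  (499 / 500 * a ^+ 2 - (a - 1) ^+ 2 - g') * w ^+ 2
  + 2 * (b * (g' - (a - 1))) * w * u
  + (499 / 500 * a ^+ 2 * g - (1 + g') * b ^+ 2) * u ^+ 2.
  have -> : a ^+ 2 * (w' ^+ 2 + g' * u' ^+ 2) = (a * w') ^+ 2 + g' * (a * u') ^+ 2 by ring.
  by rewrite hw hu; field.
have s1 : 0 <= b ^+ 2 by exact: sqr_ge0.
(* The leading coefficient of the form is 2a - 1 - g' - a^2/500; with a^2 <= 25/4 this lower bound
   makes it positive. *)
have k : 1 / 16 <= 2 * a - 1 - g'.
  rewrite leNgt; apply/negP => h.
  have : g * (2 * a - 1 - g') <= 9 / 5 * (1 / 16) by nra.
  lra.
apply: psd_form; first by nra.
rewrite -subr_ge0.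
(* The only harmful correction is 2 a^2 g / 500, at most 9/200 and hence below the margin 1/8. *)
have -> : (499 / 500 * a ^+ 2 - (a - 1) ^+ 2 - g') * (499 / 500 * a ^+ 2 * g - (1 + g') * b ^+ 2) - (b * (g' - (a - 1))) ^+ 2
 = a ^+ 2 * ((g * (2 * a - 1 - g') - b ^+ 2)
      - 1 / 500 * (2 * a ^+ 2 * g - g * ((a - 1) ^+ 2 + g') - (1 + g') * b ^+ 2)
      + (1 / 500) ^+ 2 * a ^+ 2 * g) by field.
apply: mulr_ge0; first exact: ltW.
have h1 : a ^+ 2 <= 25 / 4 by nra.
have h2 : a ^+ 2 * g <= 25 / 4 * (9 / 5) by apply: ler_pM => //; exact: ltW.
have h3 : 0 <= g * ((a - 1) ^+ 2 + g') by rewrite mulr_ge0 // addr_ge0 ?sqr_ge0.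
have h4 : 0 <= (1 + g') * b ^+ 2 by rewrite mulr_ge0 //; lra.
have h5 : 0 <= a ^+ 2 * g by rewrite mulr_ge0 // ltW.
by lra.
Qed.

(** * Decay of the DOC kernels *)

(** [D3] with the difference quotients replaced by an arbitrary sequence, so that they can be
    truncated or solved for. *)
Definition bdf3_conv t w n : R :=
  d0 (ratio t n) (ratio t n.-1) * w n
  + d1 (ratio t n) (ratio t n.-1) * w n.-1
  + d2 (ratio t n) (ratio t n.-1) * w n.-2.

Lemma bdf3_convE t w n : (3 <= n)%N -> w 1%N = 0 -> w 2%N = 0 ->
  bdf3_conv t w n = \sum_(3 <= k < n.+1) bdf3_kernel t n (n - k) * w k.
Proof.
move=> n3 w1 w2; transitivity (\sum_(1 <= k < n.+1) bdf3_kernel t n (n - k) * w k); last first.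
  rewrite (@big_cat_nat _ _ _ 3) //=; last nat_lia.
  by rewrite 2?big_ltn // big_geq // w1 w2 !mulr0 !add0r.
case: n n3 => [|[|n]] // n3; rewrite !big_nat_recr //=; [|nat_lia..].
rewrite big_nat_cond big1 => [|k /andP[/andP[_ kn] _]].
  have -> : (n.+2 - n = 2)%N by nat_lia.
  have -> : (n.+2 - n.+1 = 1)%N by nat_lia.
  by rewrite subnn /bdf3_conv /=; ring.
by have [m ->] : exists m, (n.+2 - k = m.+3)%N; [exists (n - k.+1)%N; nat_lia|rewrite mul0r].
Qed.

(** The defining recursion of the DOC kernels, multiplied by the diagonal entry. *)
Lemma doc_orthogonal t n k : (3 <= k < n)%N -> bdf3_kernel t k 0 != 0 ->
  \sum_(k <= j < n.+1) doc t n (n - j) * bdf3_kernel t j (j - k) = 0.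
Proof.
move=> /andP[k3 kn] dk; rewrite big_ltn; last by nat_lia.
by rewrite docE ?k3 // subnn div1r mulrAC mulNr mulVf // mulN1r addNr.
Qed.

(** The DOC kernels form a left inverse of the triangular kernel matrix: after exchanging the sums,
    orthogonality leaves only the term k = n. *)
Lemma doc_inversion t w n : (3 <= n)%N -> w 1%N = 0 -> w 2%N = 0 ->
  (forall k, (3 <= k <= n)%N -> bdf3_kernel t k 0 != 0) ->
  \sum_(3 <= j < n.+1) doc t n (n - j) * bdf3_conv t w j = w n.
Proof.
move=> n3 w1 w2 dn0.
transitivity (\sum_(3 <= j < n.+1) \sum_(3 <= k < j.+1)
    doc t n (n - j) * bdf3_kernel t j (j - k) * w k).
  apply: eq_big_nat => j /andP[j3 jn]; rewrite bdf3_convE // mulr_sumr.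
  by apply: eq_bigr => k _; rewrite mulrA.
rewrite exchange_triangle big_nat_recr //= big_nat_cond big1.
  by rewrite add0r big_nat1 subnn doc0 div1r mulVf ?mul1r // dn0 // n3 /=.
move=> k /andP[/andP[k3 kn] _].
by rewrite -mulr_suml doc_orthogonal ?mul0r ?k3 // dn0 // k3 ltnW.
Qed.

(** Forward substitution for [bdf3_conv] with right side [g]. The pair holds the values at n and n -
    1, which makes the two-term memory structurally recursive. *)
Fixpoint bdf3_solve t g n : R * R :=
  if n is m.+1 then
    let: (p, q) := bdf3_solve t g m in
    ((g n - d1 (ratio t n) (ratio t m) * p - d2 (ratio t n) (ratio t m) * q)
     / d0 (ratio t n) (ratio t m), p)
  else (0, 0).

Definition bdf3_sol t g n := (bdf3_solve t g n).1.

Lemma bdf3_sol_conv t g n : (2 <= n)%N -> bdf3_kernel t n 0 != 0 ->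
  bdf3_conv t (bdf3_sol t g) n = g n.
Proof.
case: n => [|[|n]] // _; rewrite /bdf3_conv /bdf3_sol /= => dn.
by case: (bdf3_solve t g n) => p q /=; rewrite mulrC divfK // addrAC !subrK.
Qed.

Lemma bdf3_sol_eq0 t g n : (forall k, (0 < k <= n)%N -> g k = 0) ->
  bdf3_sol t g n = 0.
Proof.
move=> gn; rewrite /bdf3_sol; suff -> : bdf3_solve t g n = (0, 0) by [].
elim: n gn => //= n IH gn; rewrite IH => [|k /andP[k0 kn]].
  by rewrite gn ?leqnn // !mulr0 !subr0 mul0r.
by apply: gn; rewrite k0 leqW.
Qed.

(** Column i of the inverse is the response to a unit impulse at i. This turns bounds on DOC kernels
    into bounds on solutions of the homogeneous recurrence. *)
Lemma doc_solE t n i : (3 <= i <= n)%N ->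
  (forall k, (3 <= k <= n)%N -> bdf3_kernel t k 0 != 0) ->
  doc t n (n - i) = bdf3_sol t (fun k => (k == i)%:R) n.
Proof.
move=> /andP[i3 ni] dn0; rewrite -[RHS](@doc_inversion t _ n) //.
- rewrite (eq_big_nat _ _ (F2 := fun j => doc t n (n - j) * (j == i)%:R)).
    rewrite (bigD1_seq i) ?mem_index_iota ?iota_uniq ?i3 ?ltnS //= eqxx mulr1 big1 ?addr0 //.
    by move=> j /negPf ->; rewrite mulr0.
  move=> j /andP[j3 jn]; rewrite bdf3_sol_conv //; first nat_lia.
  by apply: dn0; rewrite j3 -ltnS.
- nat_lia.
- by apply: bdf3_sol_eq0 => k /andP[_ k1]; case: eqP => // e; nat_lia.
- by apply: bdf3_sol_eq0 => k /andP[_ k1]; case: eqP => // e; nat_lia.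
Qed.

Lemma bdf3_kernel0_neq0 N t n :
  (forall k, (2 <= k <= N)%N -> 0 <= ratio t k <= 64 / 25) ->
  (3 <= n <= N)%N -> bdf3_kernel t n 0 != 0.
Proof.
move=> rt nN; have /andP[x0 _] := rt n ltac:(nat_lia).
have /andP[y0 _] := rt n.-1 ltac:(nat_lia).
by rewrite gt_eqF //= (lt_le_trans ltr01) // d0_ge1.
Qed.

Lemma bdf3_energy_decay N t i m :
  (forall k, (2 <= k <= N)%N -> 0 <= ratio t k <= 64 / 25) ->
  (3 <= i)%N -> (i + m <= N)%N ->
  let w := bdf3_sol t (fun k => (k == i)%:R) in
  w (i + m)%N ^+ 2 + (1 + ratio t (i + m)) / 2 * (w (i + m)%N - w (i + m).-1) ^+ 2
    <= 3 * (499 / 500) ^+ m.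
Proof.
move=> rt i3 imN /=; set w := bdf3_sol _ _.
have conv n : (3 <= n <= N)%N -> bdf3_conv t w n = (n == i)%:R.
  move=> nN; apply: bdf3_sol_conv; first nat_lia.
  exact: bdf3_kernel0_neq0 rt nN.
have coefs n : (3 <= n <= N)%N ->
    [/\ 0 <= ratio t n <= 64 / 25, 0 <= ratio t n.-1 <= 64 / 25
      & d1 (ratio t n) (ratio t n.-1) =
          1 - d0 (ratio t n) (ratio t n.-1) - d2 (ratio t n) (ratio t n.-1)].
  move=> nN; have rn := rt n ltac:(nat_lia); have rn1 := rt n.-1 ltac:(nat_lia).
  by split=> //; rewrite d1E //; case/andP: rn.
elim: m imN => [|m IH] imN.
  (* At the impulse d0 w_i = 1 with d0 >= 1, so the energy is at most 1 + (1 + 64/25) / 2 = 139/50,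
     below 3. *)
  have [rn rn1 _] := coefs i ltac:(nat_lia).
  have w0 n : (n < i)%N -> w n = 0.
    by move=> ni; apply: bdf3_sol_eq0 => k kn; case: eqP => // e; nat_lia.
  have := conv i ltac:(nat_lia); rewrite addn0 /bdf3_conv eqxx.
  rewrite !(w0 i.-1) ?(w0 i.-2) ?mulr0 ?addr0 ?subr0; [|nat_lia..].
  set a := d0 _ _ => wa.
  have a1 : 1 <= a by apply: d0_ge1; [case/andP: rn|case/andP: rn1].
  have w2 : w i ^+ 2 <= 1.
    have <- : (a * w i) ^+ 2 = 1 by rewrite wa expr1n.
    by rewrite exprMn ler_peMl ?sqr_ge0 // exprn_ege1.
  have ? : 0 <= w i ^+ 2 by rewrite sqr_ge0.
  by rewrite expr0; case/andP: rn => ? ?; nra.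
have nN : (3 <= (i + m).+1 <= N)%N by nat_lia.
have [rn rn1 e1] := coefs _ nN.
rewrite addnS; have := conv _ nN; rewrite /bdf3_conv /= in rn1 e1 *.
rewrite (_ : (i + m).+1 == i = false); last by apply/eqP; nat_lia.
have /andP[x0 x1] := rn; have /andP[y0 y1] := rn1.
have mg := bdf3_margin rn y0.
have a1 := d0_ge1 x0 y0; have a2 := d0_le rn rn1.
rewrite {}e1 => wE.
apply: le_trans (energy_contraction (a := d0 (ratio t (i + m).+1) (ratio t (i + m)))
   (b := d2 (ratio t (i + m).+1) (ratio t (i + m)))
   (g := (1 + ratio t (i + m)) / 2) (w := w (i + m)%N)
   (u := w (i + m)%N - w (i + m).-1) _ _ _ _ _ _) _.
- by rewrite a1 a2.
- by apply/andP; split; lra.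
- by lra.
- by move: mg; lra.
(* Both recurrences, for w and for its increment, are the homogeneous equation with d1 = 1 - d0 -
   d2. *)
- by apply/eqP; rewrite -subr_eq0 -[X in _ == X]wE; apply/eqP; ring.
- by apply/eqP; rewrite -subr_eq0 -[X in _ == X]wE; apply/eqP; ring.
by rewrite [in leRHS]exprS [leRHS]mulrCA ler_pM2l; [apply: IH; nat_lia|lra].
Qed.

(** Square root of the energy decay, using 3 <= 2^2 and 499/500 <= (999/1000)^2. *)
Lemma doc_decay N t i n :
  (forall k, (2 <= k <= N)%N -> 0 <= ratio t k <= 64 / 25) ->
  (3 <= i <= n)%N -> (n <= N)%N ->
  `|doc t n (n - i)| <= 2 * (999 / 1000) ^+ (n - i).
Proof.
move=> rt /andP[i3 ni] nN; rewrite doc_solE ?i3 //; last first.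
  by move=> k kn; apply: (bdf3_kernel0_neq0 rt); nat_lia.
have imN : (i + (n - i) <= N)%N by nat_lia.
have := bdf3_energy_decay rt i3 imN; rewrite subnKC //=.
set w := bdf3_sol _ _; set m := (n - i)%N => E.
have p0 : 0 <= 2 * (999 / 1000) ^+ m :> R by rewrite mulr_ge0 // exprn_ge0 //; lra.
rewrite -(@ler_pXn2r _ 2) ?nnegrE // real_normK ?num_real //.
have /andP[r0 _] := rt n ltac:(nat_lia).
have u0 : 0 <= (1 + ratio t n) / 2 * (w n - w n.-1) ^+ 2.
  by rewrite mulr_ge0 ?sqr_ge0 //; lra.
apply: le_trans (_ : 3 * (499 / 500) ^+ m <= _); first by apply: le_trans E; lra.
rewrite [leRHS]exprMn -exprM mulnC exprM ler_pM //; first by rewrite exprn_ge0 //; lra.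
  by lra.
by apply: lerXn2r; rewrite ?nnegrE; lra.
Qed.

Lemma geometric_sum_le i n :
  \sum_(i <= j < n) 2 * (999 / 1000) ^+ (j - i) <= 2000 :> R.
Proof.
have [ni|/ltnW ni] := leqP n i; first by rewrite big_geq //; lra.
rewrite -(subnKC ni); move: (n - i)%N => m.
(* The full geometric series sums to 2 / (1 - 999/1000) = 2000. *)
suff -> : \sum_(i <= j < i + m) 2 * (999 / 1000) ^+ (j - i) =
    2000 * (1 - (999 / 1000) ^+ m) :> R.
  have : 0 <= (999 / 1000 : R) ^+ m by rewrite exprn_ge0 //; lra.
  lra.
elim: m => [|m IH]; first by rewrite addn0 big_geq //= subrr mulr0.
by rewrite addnS big_nat_recr /= ?leq_addr // IH addKn exprS; field.
Qed.

Lemma doc_bound_uniform N t :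
  (forall k, (2 <= k <= N)%N -> 0 <= ratio t k <= 64 / 25) ->
  doc_bound 2000 N t.
Proof.
move=> rt n i /andP[i3 ni] nN; split.
  apply: le_trans (geometric_sum_le 3 n.+1).
  rewrite [leRHS]big_nat_rev; apply: ler_sum_nat => j /andP[j3 jn].
  have -> : (3 + n.+1 - j.+1 - 3 = n - j)%N by nat_lia.
  by apply: (doc_decay rt); nat_lia.
apply: le_trans (geometric_sum_le i n.+1); apply: ler_sum_nat => j /andP[ij jn].
by apply: (doc_decay rt); nat_lia.
Qed.

(** * Stability *)

Lemma term_le_bigmax_nat (F : nat -> R) a b j : (a <= j < b)%N ->
  F j <= \big[Num.max/0]_(a <= i < b) F i.
Proof. by move=> jab; apply: le_bigmax_seq => //; rewrite mem_index_iota. Qed.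

Lemma bigmax_nat_le (F : nat -> R) a b (m : R) : 0 <= m ->
  (forall j, (a <= j < b)%N -> F j <= m) ->
  \big[Num.max/0]_(a <= i < b) F i <= m.
Proof.
move=> m0 Fm; rewrite big_nat_cond; apply: bigmax_le => // j.
by rewrite andbT => /Fm.
Qed.

(** The inequality is implicit: its sum contains the term n = m. As a_m <= 1/4, that term is
    absorbed on the left at the cost of a factor 2. The explicit right side then grows by at most 1
    + 2 a_n <= exp(2 a_n) per step. *)
Lemma discrete_gronwall (a M : nat -> R) (Q : R) s p : (s <= p)%N -> 0 <= Q ->
  (forall n, 0 <= a n) -> (forall n, (n <= p)%N -> a n <= 1 / 4) ->
  (forall n, 0 <= M n) ->
  (forall m, (s <= m <= p)%N -> M m <= Q + \sum_(s <= n < m.+1) a n * M n) ->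
  M p <= 2 * Q * expR (2 * \sum_(s <= n < p) a n).
Proof.
move=> sp Q0 a0 a1 M0 MQ.
have S0 m : 0 <= \sum_(s <= n < m) a n * M n.
  by apply: sumr_ge0 => n _; rewrite mulr_ge0.
have Mle m : (s <= m <= p)%N -> M m <= 2 * (Q + \sum_(s <= n < m) a n * M n).
  move=> /andP[sm mp]; have := MQ m; rewrite sm mp big_nat_recr //= => /(_ isT).
  have := S0 m; have : a m * M m <= 1 / 4 * M m by rewrite ler_wpM2r // a1.
  by have := M0 m; lra.
apply: le_trans (Mle _ _) _; first by rewrite sp leqnn.
suff H m : (s + m <= p)%N -> Q + \sum_(s <= n < s + m) a n * M n <=
    Q * expR (2 * \sum_(s <= n < s + m) a n).
  by have := H (p - s)%N; rewrite subnKC // leqnn => /(_ isT); lra.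
elim: m => [|m IH] mp; first by rewrite addn0 !big_geq // mulr0 expR0 mulr1 addr0.
rewrite addnS !big_nat_recr ?leq_addr //= mulrDr expRD mulrA.
have smp : (s + m <= p)%N by nat_lia.
apply: le_trans (_ : (Q + \sum_(s <= n < s + m) a n * M n) * (1 + 2 * a (s + m)%N) <= _).
  have := Mle (s + m)%N; rewrite leq_addr smp => /(_ isT).
  by move=> /(ler_wpM2l (a0 (s + m)%N)); lra.
apply: ler_pM.
- by rewrite addr_ge0.
- by have := a0 (s + m)%N; lra.
- exact: IH.
- exact: expR_ge1Dx.
Qed.

(** * Elementary facts on time grids *)

Section Grid.
Variables (T : R) (N : nat) (t : nat -> R).
Hypothesis tg : time_grid T N t.

Lemma step_gt0 n : (0 < n <= N)%N -> 0 < step t n.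
Proof. by case: tg => _ _ h /h; rewrite /step subr_gt0. Qed.

Lemma step_le_max n : (0 < n <= N)%N -> step t n <= max_step N t.
Proof. by move=> nN; apply: term_le_bigmax_nat; nat_lia. Qed.

Lemma max_step_ge0 : 0 <= max_step N t.
Proof. exact: bigmax_ge_id. Qed.

Lemma sum_step a n : (0 < a <= n)%N -> \sum_(a <= k < n) step t k = t n.-1 - t a.-1.
Proof.
move=> /andP[a0 an]; rewrite -(subnKC an); elim: (n - a)%N => [|m IH].
  by rewrite addn0 big_geq // subrr.
rewrite addnS big_nat_recr ?leq_addr //= IH /step; ring.
Qed.

Lemma grid_ge0 n : (n <= N)%N -> 0 <= t n.
Proof.
case: tg => t0 _ h; elim: n => [|n IH] nN; first by rewrite t0.
by exact: le_trans (IH (ltnW nN)) (ltW (h n.+1 nN)).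
Qed.

Lemma grid_gt0 n : (0 < n <= N)%N -> 0 < t n.
Proof.
case: tg => _ _ h /andP[n0 nN]; apply: le_lt_trans (h n _); last nat_lia.
by apply: grid_ge0; nat_lia.
Qed.

Lemma grid_mono m n : (m <= n)%N -> (n <= N)%N -> t m <= t n.
Proof.
case: tg => _ _ h mn; rewrite -(subnKC mn); elim: (n - m)%N => [|k IH] kN.
  by rewrite addn0.
rewrite addnS in kN *; exact: le_trans (IH (ltnW kN)) (ltW (h (m + k).+1 kN)).
Qed.

Lemma grid_le_end n : (n <= N)%N -> t n <= T.
Proof. by case: (tg) => _ <- _ nN; exact: grid_mono. Qed.

Lemma ratio_bounds r : r <= 64 / 25 -> ratios_below r N t ->
  forall k, (2 <= k <= N)%N -> 0 <= ratio t k <= 64 / 25.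
Proof. by move=> r1 rt k /rt /andP[a b]; apply/andP; split; lra. Qed.

Lemma norm_le_sum_dtau v n : (2 <= n <= N)%N ->
  `|v n| <= `|v 2%N| + \sum_(3 <= k < n.+1) step t k * `|dtau t v k|.
Proof.
move=> /andP[n2]; rewrite -(subnKC n2); elim: (n - 2)%N => [|m IH] mN.
  by rewrite addn0 big_geq // addr0.
rewrite addnS in mN *; rewrite big_nat_recr /=; last nat_lia.
rewrite addrA; apply: le_trans (lerD (IH (ltnW mN)) (lexx _)).
have st : 0 < step t (2 + m).+1 by apply: step_gt0.
rewrite -[X in X * `|_|](ger0_norm (ltW st)) -normrM.
apply: le_trans (ler_normD _ _); rewrite /dtau mulrC divfK ?gt_eqF //=.
by rewrite addrC subrK.
Qed.

End Grid.

(** Zeroing the starting values makes [doc_inversion] applicable; [start_defect] is the resulting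
    change of the right side. *)
Definition tail3 w n : R := if (n < 3)%N then 0 else w n.

Definition start_defect t w n : R := bdf3_conv t w n - bdf3_conv t (tail3 w) n.

(** The stencil reaches the starting values only at n = 3 and n = 4. The coefficients come from |d1|
    <= d0 + d2 - 1 <= 13/4 and d2 <= 7/4: 13/4 + 7/4 = 5 for w_2, and 7/4 <= 2 for w_1. *)
Lemma start_defect_sum N t w n :
  (forall k, (2 <= k <= N)%N -> 0 <= ratio t k <= 64 / 25) ->
  (n <= N)%N ->
  \sum_(3 <= j < n.+1) `|start_defect t w j| <= 5 * `|w 2%N| + 2 * `|w 1%N|.
Proof.
move=> rt nN; have [n3|n3] := ltnP n 3.
  by rewrite big_geq // addr_ge0 ?mulr_ge0.
have r2 := rt 2%N ltac:(nat_lia); have r3 := rt 3%N ltac:(nat_lia).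
have /andP[r20 _] := r2; have /andP[r30 _] := r3.
have e3 : `|start_defect t w 3| <= 13 / 4 * `|w 2%N| + 7 / 4 * `|w 1%N|.
  have -> : start_defect t w 3 = d1 (ratio t 3) (ratio t 2) * w 2%N
      + d2 (ratio t 3) (ratio t 2) * w 1%N.
    by rewrite /start_defect /bdf3_conv /tail3 /=; ring.
  apply: le_trans (ler_normD _ _) _; rewrite [X in X + _]normrM [X in _ + X]normrM.
  have a1 := d0_le r3 r2; have a2 := d0_ge1 r30 r20.
  have b1 := d2_le r3 r2; have b2 := d2_ge0 r30 r20.
  apply: lerD; apply: ler_wpM2r => //.
    by rewrite d1E // ler_norml; apply/andP; split; lra.
  by rewrite ger0_norm.
have [n4|n4] := boolP (n == 3%N).
  rewrite (eqP n4) big_nat1; apply: le_trans e3 _.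
  by have := normr_ge0 (w 1%N); have := normr_ge0 (w 2%N); lra.
have r4 := rt 4%N ltac:(nat_lia); have /andP[r40 _] := r4.
have e4 : `|start_defect t w 4| <= 7 / 4 * `|w 2%N|.
  have -> : start_defect t w 4 = d2 (ratio t 4) (ratio t 3) * w 2%N.
    by rewrite /start_defect /bdf3_conv /tail3 /=; ring.
  by rewrite normrM ler_wpM2r // ger0_norm ?d2_ge0 ?d2_le.
rewrite big_ltn; last nat_lia.
rewrite big_ltn; last nat_lia.
rewrite big_nat_cond big1 => [|j /andP[/andP[j5 _] _]].
  by have := normr_ge0 (w 1%N); lra.
rewrite /start_defect /bdf3_conv /tail3.
by rewrite !ifF ?subrr ?normr0 //; apply/negbTE; rewrite -leqNgt; nat_lia.
Qed.

Lemma doc_stability T N t (C3 L : R) (vt g eps : nat -> R) n :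
  time_grid T N t ->
  (forall k, (2 <= k <= N)%N -> 0 <= ratio t k <= 64 / 25) ->
  0 < C3 -> doc_bound C3 N t -> 0 < L ->
  (forall j, (3 <= j <= N)%N -> D3 t vt j = g j + eps j) ->
  (forall j, (3 <= j <= N)%N -> `|g j| <= L * `|vt j|) ->
  max_step N t <= 1 / (4 * C3 * L) -> (3 <= n <= N)%N ->
  `|vt n| <= 2 * expR (4 * C3 * L * t n.-1) *
    (`|vt 2%N| + 5 * C3 * max_step N t * `|dtau t vt 2|
     + 2 * C3 * max_step N t * `|dtau t vt 1|
     + 2 * C3 * t n * \big[Num.max/0]_(3 <= i < n.+1) `|eps i|).
Proof.
move=> tg rt C0 db L0 eqn gL tau_le /andP[n3 nN].
set e := \big[_/_]_(3 <= i < _) _; set tau := max_step N t in tau_le *.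
set w := dtau t vt.
have e0 : 0 <= e by apply: bigmax_ge_id.
have tau0 : 0 <= tau by apply: max_step_ge0.
have tn0 : 0 <= t n by apply: (grid_ge0 tg).
pose M k := \big[Num.max/0]_(2 <= j < k.+1) `|vt j|.
pose h := start_defect t w.
have st0 k : (3 <= k <= n)%N -> 0 <= step t k.
  by move=> kn; apply/ltW/(step_gt0 tg); nat_lia.
(* Inverting the scheme, row sums bound the Lipschitz and perturbation parts. The defect stays under
   the sum: bounding it termwise and summing over k would lose the factor tau. *)
have wE k : (3 <= k <= n)%N -> `|w k| <=
    C3 * (L * M k + e) + \sum_(3 <= j < k.+1) `|doc t k (k - j)| * `|h j|.
  move=> /andP[k3 kn].
  have -> : w k = \sum_(3 <= j < k.+1) doc t k (k - j) * (g j + eps j - h j).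
    have <- : tail3 w k = w k by rewrite /tail3 ltnNge k3.
    rewrite -(doc_inversion (t := t)) //; last first.
      by move=> j jk; apply: (bdf3_kernel0_neq0 rt); nat_lia.
    apply: eq_big_nat => j /andP[j3 jk]; rewrite -eqn; last nat_lia.
    by rewrite /h /start_defect opprB addrC subrK.
  apply: le_trans (ler_norm_sum _ _ _) _.
  apply: le_trans (_ : \sum_(3 <= j < k.+1)
      (`|doc t k (k - j)| * (L * M k + e) + `|doc t k (k - j)| * `|h j|) <= _).
    apply: ler_sum_nat => j /andP[j3 jk]; rewrite normrM -mulrDr ler_wpM2l //.
    apply: le_trans (ler_normB _ _) _; apply: lerD => //.
    apply: le_trans (ler_normD _ _) _; apply: lerD.
      apply: le_trans (gL j _) _; first nat_lia.
      rewrite ler_pM2l //; apply: (term_le_bigmax_nat (fun j => `|vt j|)); nat_lia.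
    by apply: (term_le_bigmax_nat (fun j => `|eps j|)); nat_lia.
  rewrite big_split /= lerD2r -mulr_suml; apply: ler_wpM2r.
    rewrite addr_ge0 // mulr_ge0 ?(ltW L0) //; exact: bigmax_ge_id.
  by have [] := db k 3%N; rewrite ?leqnn //; nat_lia.
pose Q := `|vt 2%N| + C3 * t n * e + tau * C3 * (5 * `|w 2%N| + 2 * `|w 1%N|).
have Q0 : 0 <= Q.
  rewrite !addr_ge0 // ?mulr_ge0 ?addr_ge0 ?mulr_ge0 //; exact: ltW.
have vtQ m : (2 <= m <= n)%N ->
    `|vt m| <= Q + \sum_(3 <= k < m.+1) C3 * L * step t k * M k.
  move=> /andP[m2 mn].
  apply: le_trans (norm_le_sum_dtau tg _ _) _; first nat_lia.
  apply: le_trans (_ : `|vt 2%N| + \sum_(3 <= k < m.+1)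
     (C3 * L * step t k * M k + C3 * e * step t k
      + \sum_(3 <= j < k.+1) tau * (`|doc t k (k - j)| * `|h j|)) <= _).
    rewrite lerD2l; apply: ler_sum_nat => k /andP[k3 km].
    apply: le_trans (ler_wpM2l (st0 k _) (wE k _)) _; [nat_lia..|].
    rewrite mulrDr; apply: lerD; first by rewrite le_eqVlt; apply/orP; left; apply/eqP; ring.
    rewrite -mulr_sumr; apply: ler_wpM2r.
      by apply: sumr_ge0 => j _; rewrite mulr_ge0.
    by apply: (step_le_max); nat_lia.
  rewrite !big_split /= exchange_triangle /Q -mulr_sumr (sum_step t); last nat_lia.
  have H1 : C3 * e * (t m.+1.-1 - t 3.-1) <= C3 * t n * e.
    rewrite mulrAC ler_wpM2r // ler_pM2l //=.
    have := grid_ge0 tg (n := 2) ltac:(nat_lia); have := grid_mono tg mn nN.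
    lra.
  (* With the order of summation exchanged, the column sums of the DOC kernels bound the defect
     part. *)
  have H2 : \sum_(3 <= j < m.+1) \sum_(j <= k < m.+1) tau * (`|doc t k (k - j)| * `|h j|)
     <= tau * C3 * (5 * `|w 2%N| + 2 * `|w 1%N|).
    apply: le_trans (_ : \sum_(3 <= j < m.+1) tau * C3 * `|h j| <= _).
      apply: ler_sum_nat => j /andP[j3 jm].
      rewrite -mulr_sumr -mulr_suml -mulrA ler_wpM2l // ler_wpM2r //.
      by have [] := db m j; rewrite ?j3 //; nat_lia.
    rewrite -mulr_sumr ler_wpM2l //; first by rewrite mulr_ge0 // ltW.
    by apply: (start_defect_sum _ rt); nat_lia.
  lra.
have M0 k : 0 <= M k by exact: bigmax_ge_id.
have sum_ge0 m1 m2 : (m2 <= n)%N -> (3 <= m1)%N ->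
    0 <= \sum_(m1 <= k < m2.+1) C3 * L * step t k * M k.
  move=> m2n m13; rewrite big_nat_cond; apply: sumr_ge0 => k /andP[/andP[k1 k2] _].
  rewrite !mulr_ge0 ?(ltW C0) ?(ltW L0) //; apply: st0; nat_lia.
(* Truncated at zero outside the grid so that it is nonnegative everywhere. *)
pose a k := if (3 <= k <= n)%N then C3 * L * step t k else 0.
have aE m : (m <= n)%N -> forall F : nat -> R,
    \sum_(3 <= k < m.+1) a k * F k = \sum_(3 <= k < m.+1) C3 * L * step t k * F k.
  move=> mn F; apply: eq_big_nat => k /andP[k3 km]; rewrite /a ifT //; nat_lia.
(* The bound [vtQ] is nondecreasing in its index, so it passes to the running maximum [M]. *)
have MQ m : (3 <= m <= n)%N -> M m <= Q + \sum_(3 <= k < m.+1) a k * M k.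
  move=> /andP[m3 mn]; rewrite aE //; apply: bigmax_nat_le => [|j /andP[j2 jm]].
    by rewrite addr_ge0 // sum_ge0.
  apply: le_trans (vtQ j _) _; first nat_lia.
  rewrite lerD2l (@big_cat_nat _ _ _ j.+1 3 m.+1) //=.
  by rewrite lerDl sum_ge0.
have a0 k : 0 <= a k.
  rewrite /a; case: ifP => // kn; rewrite !mulr_ge0 ?(ltW C0) ?(ltW L0) //; exact: st0.
have CL0 : 0 < C3 * L by exact: mulr_gt0.
have tauCL : C3 * L * tau <= 1 / 4.
  move: tau_le; rewrite ler_pdivlMr; last by rewrite -mulrA mulr_gt0.
  lra.
have a1 k : (k <= n)%N -> a k <= 1 / 4.
  move=> kn; rewrite /a; case: ifP => [kn3|_]; last by lra.
  apply: le_trans tauCL; rewrite ler_pM2l //; apply: step_le_max; nat_lia.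
have := discrete_gronwall n3 Q0 a0 a1 M0 MQ.
have -> : \sum_(3 <= k < n) a k = C3 * L * (t n.-1 - t 2%N).
  rewrite -(sum_step t (a := 3)) // mulr_sumr.
  by apply: eq_big_nat => k /andP[k3 kn]; rewrite /a ifT //; nat_lia.
move=> Mn.
have vM : `|vt n| <= M n by apply: (term_le_bigmax_nat (fun j => `|vt j|)); nat_lia.
apply: le_trans vM _; apply: le_trans Mn _.
rewrite mulrAC; apply: ler_pM => //.
- by rewrite mulr_ge0 ?expR_ge0.
(* Gronwall gives the smaller exponent 2 C3 L (t_(n-1) - t_2); it is relaxed to the stated one. *)
- rewrite ler_pM2l // ler_expR.
  have : 0 <= C3 * L * t 2%N by rewrite mulr_ge0 ?(ltW CL0) // (grid_ge0 tg) //; nat_lia.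
  have : 0 <= C3 * L * t n.-1 by rewrite mulr_ge0 ?(ltW CL0) // (grid_ge0 tg) //; nat_lia.
  lra.
rewrite /Q /w.
have : 0 <= C3 * t n * e by rewrite !mulr_ge0 // ltW.
lra.
Qed.

Lemma D3B t v vbar vt n : (3 <= n)%N ->
  (forall k, (k <= n)%N -> vt k = vbar k - v k) ->
  D3 t vt n = D3 t vbar n - D3 t v n.
Proof.
case: n => [|[|[|n]]] // _ vtE; rewrite /D3 /dtau /= !vtE; [|nat_lia..].
move: (d0 _ _) (d1 _ _) (d2 _ _) => a b c.
move: (step t _)^-1 (step t _)^-1 (step t _)^-1 => s3 s2 s1.
ring.
Qed.

End Bdf3.

Theorem theorem3p1 (R : realType) :
  exists R3 : R,
    unique (@R3_root R) R3 /\
    2553%:R / 1000%:R <= R3 <= 2554%:R / 1000%:R /\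
    (exists2 C3 : R, 0 < C3 &
       forall (T : R) (N : nat) (t : nat -> R),
         time_grid T N t -> ratios_below R3 N t -> doc_bound C3 N t) /\
    forall (T Lf : R) (f : R -> R -> R),
      0 < Lf -> lipschitz_rhs f T Lf ->
      (forall (N : nat) (t : nat -> R) (C3 : R) (v vbar vt eps : nat -> R),
         time_grid T N t -> ratios_below R3 N t ->
         0 < C3 -> doc_bound C3 N t ->
         (forall n, (3 <= n <= N)%N -> D3 t v n = f (t n) (v n)) ->
         (forall n, (3 <= n <= N)%N ->
            D3 t vbar n = f (t n) (vbar n) + eps n) ->
         (forall n, (n <= N)%N -> vt n = vbar n - v n) ->
         max_step N t <= 1 / (4 * C3 * Lf) ->
         forall n, (3 <= n <= N)%N ->
           `|vt n| <=
           2 * expR (4 * C3 * Lf * t n.-1) *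
             (`|vt 2%N|
              + 5 * C3 * max_step N t * `|dtau t vt 2|
              + 2 * C3 * max_step N t * `|dtau t vt 1|
              + 2 * C3 * t n * \big[Num.max/0]_(3 <= i < n.+1) `|eps i|)) /\
      stable 3 (@D3 R) (fun N t => time_grid T N t /\ ratios_below R3 N t) f.
Proof.
have [R3 R3r /andP[R3l R3u]] := R3_root_exists R.
(* From here on, [R3] enters only through this bound, the range of the energy argument. *)
have R3le : R3 <= 64 / 25 by lra.
exists R3; split; first by split=> // y; exact: R3_root_unique.
split; first by rewrite R3l R3u.
split.
  exists 2000 => [|T N t tg rt]; first by lra.
  exact: doc_bound_uniform (ratio_bounds R3le rt).
move=> T Lf f L0 fL.
have fE N t (v vbar vt : nat -> R) : time_grid T N t ->
    (forall n, (n <= N)%N -> vt n = vbar n - v n) ->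
    forall j, (3 <= j <= N)%N ->
      `|f (t j) (vbar j) - f (t j) (v j)| <= Lf * `|vt j|.
  move=> tg vtE j /andP[j3 jN]; rewrite vtE //; apply: fL.
  by rewrite (grid_le_end tg jN) (grid_gt0 tg) //; nat_lia.
split.
  move=> N t C3 v vbar vt eps tg rt C0 db vE vbE vtE tau_le n nN.
  apply: (doc_stability tg (ratio_bounds R3le rt) C0 db L0 _
    (fE N t v vbar vt tg vtE) tau_le nN) => j jN.
  have -> : D3 t vt j = D3 t vbar j - D3 t v j.
    by apply: D3B => [|k kj]; [|apply: vtE]; nat_lia.
  by rewrite vE // vbE //; ring.
(* The constants must precede the grid, so t_n is replaced by |T|, which is nonnegative before any
   grid is given. *)
pose E := expR (4 * 2000 * Lf * `|T|).
(* The step bound is the smallness condition for C3 = 2000. The last factor adds up the coefficients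
   of the estimate, each dominating its own term. *)
exists (1 / (4 * 2000 * Lf)), (2 * E * (1 + 5 * 2000 + 2 * 2000 * `|T|)).
split; first by apply: divr_gt0 => //; apply: mulr_gt0 => //; lra.
move=> N t [tg rt] st v vbar vt eps vtE eqn.
have E0 : 0 <= E by exact: expR_ge0.
have tau_le : max_step N t <= 1 / (4 * 2000 * Lf).
  apply: bigmax_nat_le => [|k kN]; last by apply: st; nat_lia.
  by rewrite divr_ge0 // !mulr_ge0 // ltW.
set tau := max_step N t in tau_le *.
have tau0 : 0 <= tau by exact: max_step_ge0.
set S0 : R := \sum_(0 <= i < 3) _; set S1 : R := \sum_(1 <= i < 3) _.
set e : R := \big[_/_]_(3 <= i < N.+1) `|eps i|.
have e0 : 0 <= e by exact: bigmax_ge_id.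
have S00 : `|vt 2%N| <= S0.
  by rewrite /S0 3?big_ltn // big_geq // addr0 addrA lerDr addr_ge0.
have S1E : S1 = `|dtau t vt 1| + `|dtau t vt 2|.
  by rewrite /S1 2?big_ltn // big_geq // addr0.
have S0p : 0 <= S0 by exact: le_trans S00.
have S1p : 0 <= tau * S1 by rewrite mulr_ge0 // S1E addr_ge0.
have T0 : 0 <= `|T| by [].
apply: bigmax_nat_le => [|n nN].
  by rewrite mulr_ge0 ?mulr_ge0 // ?addr_ge0 // ?mulr_ge0.
have n3N : (3 <= n <= N)%N by nat_lia.
have C0 : 0 < 2000 :> R by lra.
have rb := ratio_bounds R3le rt.
apply: le_trans (doc_stability tg rb C0 (doc_bound_uniform rb) L0 eqn
  (fE N t v vbar vt tg vtE) tau_le n3N) _.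
have tT k : (k <= N)%N -> t k <= `|T|.
  by move=> kN; apply: le_trans (grid_le_end tg kN) (ler_norm _).
set en : R := \big[_/_]_(3 <= i < n.+1) _.
have en0 : 0 <= en by exact: bigmax_ge_id.
have en_le : en <= e by apply: le_bigmax_nat => //; nat_lia.
have tn0 : 0 <= t n by apply: (grid_ge0 tg); nat_lia.
rewrite -[leRHS]mulrA; apply: ler_pM.
- by rewrite mulr_ge0 ?expR_ge0.
- by rewrite !addr_ge0 ?mulr_ge0.
- rewrite ler_pM2l // ler_expR ler_pM2l; last by rewrite mulr_gt0 //; lra.
  by apply: tT; nat_lia.
have te : t n * en <= `|T| * e by apply: ler_pM => //; apply: tT; nat_lia.
have w1 : 0 <= tau * `|dtau t vt 1| by rewrite mulr_ge0.
have w2 : 0 <= tau * `|dtau t vt 2| by rewrite mulr_ge0.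
have p1 : 0 <= `|T| * S0 by rewrite mulr_ge0.
have p2 : 0 <= `|T| * (tau * S1) by rewrite mulr_ge0.
move: p2 S1p; rewrite S1E -/tau => p2 S1p.
lra.
Qed.
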